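(* Let $n\ge 1$, let $a_1,\dots,a_n$ be distinct real numbers, and let $F(a)=\sum_{k=0}^n A_k a^k=\prod_{i=1}^n(a-a_i)$. Fix signs $\epsilon_i\in\{\pm1\}$ and real numbers $\xi_1,\dots,\xi_n,\nu_n$, put $\Delta_i=\epsilon_i(a-a_i)$ and $$x(a)=\frac{\nu_n}{2}\,a+\sum_{i=1}^n\frac{\xi_i}{\sqrt{\Delta_i}},$$ and work on an open interval $I\subset(0,\infty)$ on which all $\Delta_i>0$ and $\dot x=dx/da\neq0$. On $M=I\times\mathbb{R}$ with coordinates $(a,y)$ consider $H=\Pi^2+a\,P_y^2$ with $\Pi=\frac{a}{\dot x}P_a$. Define $$G=\sum_{k=0}^n A_{n-k}H^{n-k}P_y^{2k+1},\quad Q_1=\sum_{k=0}^n\tilde b_k\,H^{n-k}\,\Pi\,P_y^{2k},\quad Q_2=\sum_{k=0}^n\tilde c_k\,H^{n-k}P_y^{2k+1},$$ where for $k=0,\dots,n$ $$\tilde b_k=(-1)^k\Big(\nu_n\sigma_k+\sum_{i=1}^n\frac{\xi_i}{\sqrt{\Delta_i}}\sigma^i_{k-1}\Big),$$ $$\tilde c_k=\frac{(-1)^{k+1}}{2}\Big\{\nu_n^2\,a\,\sigma_k+2\nu_n\sum_{i=1}^n\frac{\xi_i}{\sqrt{\Delta_i}}\big(\sigma^i_k+a\,\sigma^i_{k-1}\big)+\sum_{i=1}^n\frac{\xi_i^2}{\Delta_i}\sigma^i_{k-1}+\sum_{i\neq j}\frac{\xi_i\xi_j}{\sqrt{\Delta_i\Delta_j}}\big(\sigma^{ij}_{k-1}+a\,\sigma^{ij}_{k-2}\big)\Big\},$$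 and set $S_1=Q_1+y\,G$, $S_2=Q_2+y\,Q_1+\frac{y^2}{2}G$. Then $\{H,P_y\}=\{H,S_1\}=\{H,S_2\}=0$ and each of the triples $(H,P_y,S_1)$, $(H,P_y,S_2)$ is functionally independent; thus $\{H,P_y,S_1\}$ and $\{H,P_y,S_2\}$ are two maximally superintegrable systems.
   Context: $\{\cdot,\cdot\}$ is the canonical Poisson bracket on $T^*M$, $(P_a,P_y)$ the momenta conjugate to $(a,y)$; $H$ is the geodesic Hamiltonian of $g=\dot x^2a^{-2}da^2+a^{-1}dy^2$. Symmetric functions of the roots: $\sigma_k$ ($0\le k\le n$) by $\prod_{i}(a-a_i)=\sum_{k=0}^n(-1)^k\sigma_k a^{n-k}$; for each $i$, $\sigma^i_m$ ($-1\le m\le n$) by $\prod_{l\neq i}(a-a_l)=\sum_{m=0}^{n-1}(-1)^m\sigma^i_m a^{n-1-m}$ with $\sigma^i_{-1}=\sigma^i_n=0$; for $i\neq j$, $\sigma^{ij}_m$ ($-2\le m\le n$) by $\prod_{l\neq i,j}(a-a_l)=\sum_{m=0}^{n-2}(-1)^m\sigma^{ij}_m a^{n-2-m}$ with $\sigma^{ij}_{-2}=\sigma^{ij}_{-1}=\sigma^{ij}_{n-1}=\sigma^{ij}_n=0$. *)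

(* Defs.v *)
From HB Require Import structures.
From mathcomp Require Import all_boot all_order all_algebra.
From mathcomp Require Import all_classical all_reals all_analysis.
Set Implicit Arguments. Unset Strict Implicit. Unset Printing Implicit Defensive.
Import Order.TTheory GRing.Theory Num.Theory.
Local Open Scope ring_scope.

Section Defs.
Variable R : realType.

(* phase-space functions on T^*M, arguments (a, y, P_a, P_y) *)
Definition pfun := R -> R -> R -> R -> R.

Definition d_a (f : pfun) a y pa py := derive1 (fun t => f t y pa py) a.
Definition d_y (f : pfun) a y pa py := derive1 (fun t => f a t pa py) y.
Definition d_Pa (f : pfun) a y pa py := derive1 (fun t => f a y t py) pa.
Definition d_Py (f : pfun) a y pa py := derive1 (fun t => f a y pa t) py.

Definition pbracket (f g : pfun) : pfun := fun a y pa py =>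
  d_a f a y pa py * d_Pa g a y pa py - d_Pa f a y pa py * d_a g a y pa py
+ d_y f a y pa py * d_Py g a y pa py - d_Py f a y pa py * d_y g a y pa py.

Definition jac3 (f1 f2 f3 : pfun) a y pa py : 'M[R]_(3,4) :=
  \matrix_(i < 3, j < 4)
    (let f := nth f1 [:: f1; f2; f3] i in
     nth (d_a f) [:: d_a f; d_y f; d_Pa f; d_Py f] j a y pa py).

(* functional independence on the domain {a in I}: the differentials are
   linearly independent (Jacobian of rank 3) on a dense subset of the domain *)
Definition funct_indep (I : set R) (f1 f2 f3 : pfun) : Prop :=
  forall a y pa py, I a -> forall e : R, 0 < e ->
    exists a' y' pa' py', [/\ I a', `|a' - a| < e, `|y' - y| < e,
        `|pa' - pa| < e & `|py' - py| < e] /\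
      \rank (jac3 f1 f2 f3 a' y' pa' py') = 3%N.

Variable n : nat.
Variable ai : 'I_n -> R.

Definition Fpoly : {poly R} := \prod_(i < n) ('X - (ai i)%:P).
Definition Acoef (k : nat) : R := Fpoly`_k.
Definition Fpoly_i (i : 'I_n) : {poly R} :=
  \prod_(l < n | l != i) ('X - (ai l)%:P).
Definition Fpoly_ij (i j : 'I_n) : {poly R} :=
  \prod_(l < n | (l != i) && (l != j)) ('X - (ai l)%:P).

(* sigma_k, 0 <= k <= n :  prod_i (a - a_i) = sum_k (-1)^k sigma_k a^(n-k) *)
Definition sigma (k : nat) : R :=
  if (k <= n)%N then (-1) ^+ k * Fpoly`_(n - k) else 0.
Definition sigma_i (i : 'I_n) (m : int) : R :=
  match m with
  | Posz m' => if (m' <= n.-1)%N then (-1) ^+ m' * (Fpoly_i i)`_(n.-1 - m') else 0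
  | Negz _ => 0
  end.
Definition sigma_ij (i j : 'I_n) (m : int) : R :=
  match m with
  | Posz m' => if (m' <= n.-2)%N then (-1) ^+ m' * (Fpoly_ij i j)`_(n.-2 - m') else 0
  | Negz _ => 0
  end.

Variables (eps : 'I_n -> R) (xi : 'I_n -> R) (nu : R).

Definition Delta (i : 'I_n) (a : R) : R := eps i * (a - ai i).
Definition xfun (a : R) : R :=
  nu / 2 * a + \sum_(i < n) xi i / Num.sqrt (Delta i a).
Definition xdot (a : R) : R := derive1 xfun a.

Definition Pi : pfun := fun a y pa py => a / xdot a * pa.
Definition Ham : pfun := fun a y pa py => Pi a y pa py ^+ 2 + a * py ^+ 2.
Definition Py : pfun := fun a y pa py => py.

Definition btil (k : nat) (a : R) : R :=
  (-1) ^+ k * (nu * sigma k +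
    \sum_(i < n) xi i / Num.sqrt (Delta i a) * sigma_i i (k%:Z - 1)).

Definition ctil (k : nat) (a : R) : R :=
  (-1) ^+ k.+1 / 2 *
   (nu ^+ 2 * a * sigma k
    + 2 * nu * \sum_(i < n) xi i / Num.sqrt (Delta i a)
                  * (sigma_i i k%:Z + a * sigma_i i (k%:Z - 1))
    + \sum_(i < n) xi i ^+ 2 / Delta i a * sigma_i i (k%:Z - 1)
    + \sum_(i < n) \sum_(j < n | j != i)
         xi i * xi j / Num.sqrt (Delta i a * Delta j a)
           * (sigma_ij i j (k%:Z - 1) + a * sigma_ij i j (k%:Z - 2))).

Definition Gfun : pfun := fun a y pa py =>
  \sum_(k < n.+1) Acoef (n - k) * Ham a y pa py ^+ (n - k) * py ^+ (2 * k).+1.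
Definition Q1 : pfun := fun a y pa py =>
  \sum_(k < n.+1) btil k a * Ham a y pa py ^+ (n - k) * Pi a y pa py * py ^+ (2 * k).
Definition Q2 : pfun := fun a y pa py =>
  \sum_(k < n.+1) ctil k a * Ham a y pa py ^+ (n - k) * py ^+ (2 * k).+1.

Definition S1 : pfun := fun a y pa py => Q1 a y pa py + y * Gfun a y pa py.
Definition S2 : pfun := fun a y pa py =>
  Q2 a y pa py + y * Q1 a y pa py + y ^+ 2 / 2 * Gfun a y pa py.

End Defs.

(* Main.v *)
Require Import Defs.
From mathcomp Require Import all_boot all_order all_algebra.
From mathcomp Require Import all_classical all_reals all_analysis.
From mathcomp Require Import zify ring.
Set Implicit Arguments.
Unset Strict Implicit.
Unset Printing Implicit Defensive.
Import Order.TTheory GRing.Theory Num.Theory.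
Import numFieldNormedType.Exports.
Local Open Scope ring_scope.

(** Write [u_i = xi_i / sqrt Delta_i], [F_i = F / (X - a_i)] and a prime for
[d/da], and let [B(X)] and [C(X)] be the polynomials of degree at most [n] in which
[X^(n-k)] has the coefficients [btil_k] and [ctil_k].  Homogenized in [H] and [P_y^2]
they give [Q1 = Pi B] and [Q2 = P_y C], just as [G = P_y F].  The only analytic input
is [2 (a - a_i) u_i' = - u_i]: it turns [B = nu F - sum_i u_i F_i] into a solution of
[B - 2 (X - a) B' = 2 x' F].  Since [Pi^2 = H - a P_y^2], this says
[{H, Q1} = 2 a P_y G].  Moreover
  [2 F C = (X - a) B^2 - nu^2 X F^2 + sum_i u_i^2 (a - a_i) F_i^2],
where [u_i^2 (a - a_i) = eps_i xi_i^2] does not depend on [a]; hence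
[2 F C' = - B (B - 2 (X - a) B')], and cancelling [F] leaves [C' = - x' B], that is
[{H, Q2} = 2 a P_y Q1].

The differentials of [H], [P_y], [S] are independent as soon as [dH/dP_a] and
[dS/dy] do not vanish.  Now [S] is a polynomial in [y], nonconstant wherever [G]
does not vanish, and for [P_y <> 0] the function [G = P_y^(2n+1) F(H / P_y^2)] is a
nonzero polynomial in [P_a], so this holds on a dense set. *)

Section LieDerivative.
Context {R : realType}.
Variables a y pa py va vy vp vq : R.
Implicit Types f g H : pfun R.

Definition is_gradient f fa fy fp fq : Prop :=
  [/\ is_derive a 1 (fun t => f t y pa py) fa,
      is_derive y 1 (fun t => f a t pa py) fy,
      is_derive pa 1 (fun t => f a y t py) fp &
      is_derive py 1 (fun t => f a y pa t) fq].

(* [(va, vy, vp, vq)] is the value at [(a, y, pa, py)] of the vector field. *)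
Definition is_lie_derive f df : Prop :=
  exists fa fy fp fq, is_gradient f fa fy fp fq /\
    df = va * fa + vy * fy + vp * fp + vq * fq.

Lemma gradientE f fa fy fp fq : is_gradient f fa fy fp fq ->
  [/\ d_a f a y pa py = fa, d_y f a y pa py = fy,
      d_Pa f a y pa py = fp & d_Py f a y pa py = fq].
Proof.
by move=> [? ? ? ?]; split; rewrite /d_a /d_y /d_Pa /d_Py derive1E derive_val.
Qed.

Lemma is_gradient_eq f fa fy fp fq ga gy gp gq :
  is_gradient f fa fy fp fq -> fa = ga -> fy = gy -> fp = gp -> fq = gq ->
  is_gradient f ga gy gp gq.
Proof. by move=> ? <- <- <- <-. Qed.

Lemma is_gradientD f g fa fy fp fq ga gy gp gq :
  is_gradient f fa fy fp fq -> is_gradient g ga gy gp gq ->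
  is_gradient (fun a y pa py => f a y pa py + g a y pa py)
    (fa + ga) (fy + gy) (fp + gp) (fq + gq).
Proof.
move=> [fa_ fy_ fp_ fq_] [ga_ gy_ gp_ gq_].
by split; [exact: (is_deriveD fa_ ga_)|exact: (is_deriveD fy_ gy_)
          |exact: (is_deriveD fp_ gp_)|exact: (is_deriveD fq_ gq_)].
Qed.

Lemma is_gradientM f g fa fy fp fq ga gy gp gq :
  is_gradient f fa fy fp fq -> is_gradient g ga gy gp gq ->
  is_gradient (fun a y pa py => f a y pa py * g a y pa py)
    (f a y pa py * ga + g a y pa py * fa) (f a y pa py * gy + g a y pa py * fy)
    (f a y pa py * gp + g a y pa py * fp) (f a y pa py * gq + g a y pa py * fq).
Proof.
move=> [fa_ fy_ fp_ fq_] [ga_ gy_ gp_ gq_].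
by split; [exact: (is_deriveM fa_ ga_)|exact: (is_deriveM fy_ gy_)
          |exact: (is_deriveM fp_ gp_)|exact: (is_deriveM fq_ gq_)].
Qed.

Lemma is_gradient_base (b : R -> R) db :
  is_derive a 1 b db -> is_gradient (fun a _ _ _ => b a) db 0 0 0.
Proof. by move=> b_db; split=> //; exact: is_derive_cst. Qed.

Lemma is_gradient_y : is_gradient (fun _ y _ _ => y) 0 1 0 0.
Proof.
by split; [exact: is_derive_cst|exact: is_derive_id|exact: is_derive_cst..].
Qed.

Lemma is_gradient_Pa : is_gradient (fun _ _ pa _ => pa) 0 0 1 0.
Proof.
by split; [exact: is_derive_cst..|exact: is_derive_id|exact: is_derive_cst].
Qed.

Lemma is_gradient_Py : is_gradient (@Py R) 0 0 0 1.
Proof. by split; [exact: is_derive_cst..|exact: is_derive_id]. Qed.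

Lemma is_lie_derive_eq f df dg :
  is_lie_derive f df -> df = dg -> is_lie_derive f dg.
Proof. by move=> ? <-. Qed.

Lemma is_lie_derive_gradient f fa fy fp fq : is_gradient f fa fy fp fq ->
  is_lie_derive f (va * fa + vy * fy + vp * fp + vq * fq).
Proof. by move=> fE; exists fa, fy, fp, fq. Qed.

Lemma is_lie_derive_cst (k : R) : is_lie_derive (fun _ _ _ _ => k) 0.
Proof.
apply: is_lie_derive_eq (is_lie_derive_gradient
  (is_gradient_base (is_derive_cst k a 1))) _.
ring.
Qed.

Lemma is_lie_deriveD f g df dg :
  is_lie_derive f df -> is_lie_derive g dg ->
  is_lie_derive (fun a y pa py => f a y pa py + g a y pa py) (df + dg).
Proof.
move=> [fa [fy [fp [fq [fE ->]]]]] [ga [gy [gp [gq [gE ->]]]]].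
apply: is_lie_derive_eq (is_lie_derive_gradient (is_gradientD fE gE)) _.
ring.
Qed.

Lemma is_lie_deriveM f g df dg :
  is_lie_derive f df -> is_lie_derive g dg ->
  is_lie_derive (fun a y pa py => f a y pa py * g a y pa py)
    (f a y pa py * dg + g a y pa py * df).
Proof.
move=> [fa [fy [fp [fq [fE ->]]]]] [ga [gy [gp [gq [gE ->]]]]].
apply: is_lie_derive_eq (is_lie_derive_gradient (is_gradientM fE gE)) _.
move: (f a y pa py) (g a y pa py) => u v; ring.
Qed.

Lemma is_lie_deriveX f df k : is_lie_derive f df ->
  is_lie_derive (fun a y pa py => f a y pa py ^+ k)
    (k%:R * f a y pa py ^+ k.-1 * df).
Proof.
move=> f_df; elim: k => [|k IHk].
  by apply: is_lie_derive_eq (is_lie_derive_cst 1) _; rewrite !mul0r.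
rewrite (_ : (fun a y pa py => _) =
             (fun a y pa py => f a y pa py * f a y pa py ^+ k)); last first.
  by do 4 apply: funext => ?; rewrite exprS.
apply: is_lie_derive_eq (is_lie_deriveM f_df IHk) _.
case: k {IHk} => [|k]; rewrite ?expr0 ?mul0r /= ?exprS -?natr1; ring.
Qed.

Lemma is_lie_derive_sum (I : Type) (s : seq I) (f : I -> pfun R) (df : I -> R) :
  (forall i, is_lie_derive (f i) (df i)) ->
  is_lie_derive (fun a y pa py => \sum_(i <- s) f i a y pa py)
                (\sum_(i <- s) df i).
Proof.
move=> fdf; elim: s => [|i s IHs].
  rewrite big_nil (_ : (fun a y pa py => _) = (fun _ _ _ _ => 0)).
    exact: is_lie_derive_cst.
  by do 4 apply: funext => ?; rewrite big_nil.
rewrite big_cons (_ : (fun a y pa py => \sum_(j <- _) _) =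
  (fun a y pa py => f i a y pa py + \sum_(j <- s) f j a y pa py)).
  exact: is_lie_deriveD.
by do 4 apply: funext => ?; rewrite big_cons.
Qed.

End LieDerivative.

Lemma pbracket_near_eq {R : realType} (H f g : pfun R) (a y pa py : R) :
  (\forall t \near a, forall y pa py, f t y pa py = g t y pa py) ->
  pbracket H f a y pa py = pbracket H g a y pa py.
Proof.
move=> fg; have fga := nbhs_singleton fg; rewrite /pbracket.
have -> : d_a f a y pa py = d_a g a y pa py.
  by rewrite /d_a !derive1E; apply: near_eq_derive; apply: filterS fg => t ->.
have -> : d_y f a y pa py = d_y g a y pa py.
  by rewrite /d_y (funext (fun t => fga t pa py)).
have -> : d_Pa f a y pa py = d_Pa g a y pa py.
  by rewrite /d_Pa (funext (fun t => fga y t py)).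
have -> // : d_Py f a y pa py = d_Py g a y pa py.
by rewrite /d_Py (funext (fun t => fga y pa t)).
Qed.

Section HamiltonianFlow.
Context {R : realType}.
Variables (H : pfun R) (a y pa py Ha Hy Hp Hq : R).
Hypothesis gradH : is_gradient a y pa py H Ha Hy Hp Hq.

Lemma is_lie_derive_pbracket (f : pfun R) df :
  is_lie_derive a y pa py (- Hp) (- Hq) Ha Hy f df ->
  pbracket H f a y pa py = df.
Proof.
move=> [fa [fy [fp [fq [/gradientE[fa_ fy_ fp_ fq_] ->]]]]].
have [Ha_ Hy_ Hp_ Hq_] := gradientE gradH.
rewrite /pbracket fa_ fy_ fp_ fq_ Ha_ Hy_ Hp_ Hq_; ring.
Qed.

Lemma is_lie_derive_self : is_lie_derive a y pa py (- Hp) (- Hq) Ha Hy H 0.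
Proof.
by apply: is_lie_derive_eq (is_lie_derive_gradient _ _ _ _ gradH) _; ring.
Qed.

End HamiltonianFlow.

Section Homogenization.
Context {R : comNzRingType}.
Variable n : nat.
Implicit Types (p q : {poly R}) (x z : R).

Definition homog x z p : R :=
  \sum_(k < n.+1) p`_(n - k) * x ^+ (n - k) * z ^+ k.

Lemma homogD x z p q : homog x z (p + q) = homog x z p + homog x z q.
Proof. by rewrite -big_split; apply: eq_bigr => k _; rewrite coefD !mulrDl. Qed.

Lemma homogZ x z (c : R) p : homog x z (c *: p) = c * homog x z p.
Proof. by rewrite mulr_sumr; apply: eq_bigr => k _; rewrite coefZ !mulrA. Qed.

Lemma homog0 x z : homog x z 0 = 0.
Proof. by rewrite /homog big1 // => k _; rewrite coef0 !mul0r. Qed.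

Lemma homogMX x z p : (size p <= n)%N ->
  z * homog x z ('X * p) = x * homog x z p.
Proof.
move=> sp; rewrite /homog big_ord_recr /= subnn coefXM !mul0r addr0.
rewrite [in RHS]big_ord_recl /= subn0 nth_default // !mul0r add0r !mulr_sumr.
apply: eq_bigr => k _.
rewrite /bump leq0n add1n coefXM subn_eq0 leqNgt ltn_ord /=.
rewrite -subnS exprS -(subnSK (ltn_ord k)) exprS.
by move: (_ ^+ (n - k.+1)) (z ^+ k) => *; ring.
Qed.

Lemma homogMXsubC x z p (c : R) : (size p <= n)%N ->
  z * homog x z (('X - c%:P) * p) = (x - c * z) * homog x z p.
Proof.
move=> sp; rewrite -polyCN mulrDl mul_polyC homogD homogZ mulrDr homogMX //.
ring.
Qed.

End Homogenization.

Lemma homogE {F : fieldType} n (x z : F) (p : {poly F}) :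
  (size p <= n.+1)%N -> z != 0 ->
  homog n x z p = z ^+ n * p.[x / z].
Proof.
move=> sp z0; rewrite (horner_coef_wide _ sp) /homog.
rewrite [in LHS](reindex_inj rev_ord_inj) /=.
rewrite mulr_sumr; apply: eq_bigr => k _; rewrite subSS.
have kn : (k <= n)%N by rewrite -ltnS.
rewrite subKn // expr_div_n.
have -> : z ^+ n = z ^+ k * z ^+ (n - k) by rewrite -exprD subnKC.
by field; rewrite expf_neq0.
Qed.

Section CoefficientwiseDerivative.
Context {R : realType}.
Variable t : R.
Implicit Types (P Q : R -> {poly R}) (dP dQ : {poly R}).

Definition is_derive_coef P dP : Prop :=
  forall k, is_derive t 1 (fun s => (P s)`_k) dP`_k.

Lemma is_derive_coef_eq P dP dQ :
  is_derive_coef P dP -> dP = dQ -> is_derive_coef P dQ.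
Proof. by move=> ? <-. Qed.

Lemma is_derive_coef_unique P dP dQ :
  is_derive_coef P dP -> is_derive_coef P dQ -> dP = dQ.
Proof.
move=> PdP PdQ; apply/polyP => k.
by have [_ <-] := PdP k; have [_ <-] := PdQ k.
Qed.

Lemma is_derive_coef_cst (p : {poly R}) : is_derive_coef (fun=> p) 0.
Proof. by move=> k; rewrite coef0; exact: is_derive_cst. Qed.

Lemma is_derive_coefZl (f : R -> R) df (p : {poly R}) :
  is_derive t 1 f df -> is_derive_coef (fun s => f s *: p) (df *: p).
Proof.
move=> fdf k; rewrite (_ : (fun s => _) = (p`_k \*: f)); last first.
  by apply: funext => s; rewrite coefZ mulrC.
by rewrite coefZ mulrC; exact: is_deriveZ.
Qed.

Lemma is_derive_coefD P Q dP dQ : is_derive_coef P dP -> is_derive_coef Q dQ ->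
  is_derive_coef (fun s => P s + Q s) (dP + dQ).
Proof.
move=> PdP QdQ k.
rewrite (_ : (fun s => _) = (fun s => (P s)`_k) + (fun s => (Q s)`_k)).
  by rewrite coefD; exact: is_deriveD.
by apply: funext => s; rewrite coefD.
Qed.

Lemma is_derive_coefB P Q dP dQ : is_derive_coef P dP -> is_derive_coef Q dQ ->
  is_derive_coef (fun s => P s - Q s) (dP - dQ).
Proof.
move=> PdP QdQ k.
rewrite (_ : (fun s => _) = (fun s => (P s)`_k) - (fun s => (Q s)`_k)).
  by rewrite coefB; exact: is_deriveB.
by apply: funext => s; rewrite coefB.
Qed.

Lemma is_derive_coefM P Q dP dQ : is_derive_coef P dP -> is_derive_coef Q dQ ->
  is_derive_coef (fun s => P s * Q s) (P t * dQ + dP * Q t).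
Proof.
move=> PdP QdQ k.
rewrite (_ : (fun s => _) = \sum_(j < k.+1)
    ((fun s => (P s)`_j) * (fun s => (Q s)`_(k - j)))); last first.
  by apply: funext => s; rewrite fct_sumE coefM.
apply: is_derive_eq (is_derive_sum
  (fun j : 'I_k.+1 => is_deriveM (PdP j) (QdQ (k - j)%N))) _.
rewrite coefD !coefM -big_split; apply: eq_bigr => j _ /=.
by congr (_ + _); exact: mulrC.
Qed.

Lemma is_derive_coefZr (k : R) P dP : is_derive_coef P dP ->
  is_derive_coef (fun s => k *: P s) (k *: dP).
Proof.
move=> PdP j.
rewrite (_ : (fun s => _) = k \*: (fun s => (P s)`_j)); last first.
  by apply: funext => s; rewrite coefZ.
by rewrite coefZ; exact: is_deriveZ.
Qed.

Lemma is_derive_coef_sum (I : Type) (s : seq I) (A : pred I)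
    (P : I -> R -> {poly R}) (dP : I -> {poly R}) :
  (forall i, is_derive_coef (P i) (dP i)) ->
  is_derive_coef (fun r => \sum_(i <- s | A i) P i r)
                 (\sum_(i <- s | A i) dP i).
Proof.
move=> PdP; elim: s => [|i s IHs].
  rewrite big_nil (_ : (fun r => _) = fun=> 0); first exact: is_derive_coef_cst.
  by apply: funext => r; rewrite big_nil.
rewrite big_cons (_ : (fun r => _) = fun r =>
    if A i then P i r + \sum_(j <- s | A j) P j r
    else \sum_(j <- s | A j) P j r).
  by case: (A i) => //; exact: is_derive_coefD.
by apply: funext => r; rewrite big_cons.
Qed.

End CoefficientwiseDerivative.

Lemma is_lie_derive_homog {R : realType} n (a y pa py va vy vp vq : R)
    (f g : pfun R) (P : R -> {poly R}) dP :
  is_lie_derive a y pa py va vy vp vq f 0 ->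
  is_lie_derive a y pa py va vy vp vq g 0 ->
  is_derive_coef a P dP ->
  is_lie_derive a y pa py va vy vp vq
    (fun a y pa py => homog n (f a y pa py) (g a y pa py) (P a))
    (va * homog n (f a y pa py) (g a y pa py) dP).
Proof.
move=> f0 g0 PdP; rewrite mulr_sumr; apply: is_lie_derive_sum => k.
have Pk := is_lie_derive_gradient va vy vp vq
  (is_gradient_base y pa py (PdP (n - k)%N)).
apply: is_lie_derive_eq (is_lie_deriveM
  (is_lie_deriveM Pk (is_lie_deriveX (n - k) f0)) (is_lie_deriveX k g0)) _.
by rewrite !mulr0; move: (_ ^+ (n - k)) (_ ^+ k) => *; ring.
Qed.

Section GeodesicFlow.
Context {R : realType}.
Variables (m : R -> R) (a y pa py dm : R).
Hypothesis m_dm : is_derive a 1 m dm.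

Definition momentum : pfun R := fun a _ pa _ => m a * pa.

Definition geodesic_ham : pfun R := fun a y pa py =>
  momentum a y pa py ^+ 2 + a * py ^+ 2.

Let mom := momentum a y pa py.
Let ham := geodesic_ham a y pa py.

Lemma geodesic_ham_gradient : is_gradient a y pa py geodesic_ham
  (2 * mom * dm * pa + py ^+ 2) 0 (2 * mom * m a) (2 * a * py).
Proof.
have gm := is_gradient_base y pa py m_dm.
have gPi := is_gradientM gm (is_gradient_Pa a y pa py).
have gPy := is_gradient_Py a y pa py.
have ga := is_gradient_base y pa py (is_derive_id a (1 : R)).
have gH := is_gradientD (is_gradientM gPi gPi)
  (is_gradientM ga (is_gradientM gPy gPy)).
apply: is_gradient_eq gH _ _ _ _;
  rewrite /mom /momentum /Py; move: (m a) => u; ring.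
Qed.

Local Notation flow := (is_lie_derive a y pa py
  (- (2 * mom * m a)) (- (2 * a * py)) (2 * mom * dm * pa + py ^+ 2) 0).

Lemma flow_pbracket (f : pfun R) df :
  flow f df -> pbracket geodesic_ham f a y pa py = df.
Proof. exact: is_lie_derive_pbracket geodesic_ham_gradient _ _. Qed.

Lemma flow_ham : flow geodesic_ham 0.
Proof. exact: is_lie_derive_self geodesic_ham_gradient. Qed.

Lemma flow_Py : flow (@Py R) 0.
Proof.
apply: is_lie_derive_eq
  (is_lie_derive_gradient _ _ _ _ (is_gradient_Py _ _ _ _)) _; ring.
Qed.

Lemma flow_y : flow (fun _ y _ _ => y) (- (2 * a * py)).
Proof.
apply: is_lie_derive_eq
  (is_lie_derive_gradient _ _ _ _ (is_gradient_y _ _ _ _)) _; ring.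
Qed.

Lemma flow_momentum : flow momentum (m a * py ^+ 2).
Proof.
apply: is_lie_derive_eq (is_lie_derive_gradient _ _ _ _
  (is_gradientM (is_gradient_base y pa py m_dm) (is_gradient_Pa a y pa py))) _.
by rewrite /mom /momentum; move: (m a) => u; ring.
Qed.

Section Integrals.
Variables (n : nat) (F dB : {poly R}) (B C : R -> {poly R}) (dx : R).

Definition homog_ham (P : R -> {poly R}) : pfun R := fun a y pa py =>
  homog n (geodesic_ham a y pa py) (py ^+ 2) (P a).

Definition linear_integral : pfun R := fun a y pa py =>
  momentum a y pa py * homog_ham B a y pa py
  + y * (py * homog_ham (fun=> F) a y pa py).

Definition quadratic_integral : pfun R := fun a y pa py =>
  py * homog_ham C a y pa py
  + y * (momentum a y pa py * homog_ham B a y pa py)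
  + y ^+ 2 / 2 * (py * homog_ham (fun=> F) a y pa py).

Hypothesis size_dB : (size dB <= n)%N.
Hypothesis m_dx : m a * dx = a.
Hypothesis B_dB : is_derive_coef a B dB.
Hypothesis B_ode : B a = 2 *: (('X - a%:P) * dB) + (2 * dx) *: F.
Hypothesis C_ode : is_derive_coef a C (- dx *: B a).

Lemma flow_homog_ham P dP : is_derive_coef a P dP ->
  flow (homog_ham P) (- (2 * mom * m a) * homog n ham (py ^+ 2) dP).
Proof.
move=> PdP; apply: is_lie_derive_homog flow_ham _ PdP.
by apply: is_lie_derive_eq (is_lie_deriveX 2 flow_Py) _; rewrite mulr0.
Qed.

Lemma flow_Py_homog_F :
  flow (fun a y pa py => py * homog_ham (fun=> F) a y pa py) 0.
Proof.
have flowF := flow_homog_ham (is_derive_coef_cst a F).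
apply: is_lie_derive_eq (is_lie_deriveM flow_Py flowF) _.
by rewrite homog0 !mulr0 add0r.
Qed.

Lemma homog_B : py ^+ 2 * homog n ham (py ^+ 2) (B a)
  = 2 * mom ^+ 2 * homog n ham (py ^+ 2) dB
    + 2 * dx * py ^+ 2 * homog n ham (py ^+ 2) F.
Proof.
rewrite B_ode homogD !homogZ mulrDr [_ * (2 * _)]mulrCA homogMXsubC //.
have -> : ham - a * py ^+ 2 = mom ^+ 2 by rewrite /ham /geodesic_ham addrK.
by move: (homog _ _ _ dB) (homog _ _ _ F) => u v; ring.
Qed.

Lemma flow_momentum_homog_B :
  flow (fun a y pa py => momentum a y pa py * homog_ham B a y pa py)
       (2 * a * py * (py * homog_ham (fun=> F) a y pa py)).
Proof.
apply: is_lie_derive_eq (is_lie_deriveM flow_momentum (flow_homog_ham B_dB)) _.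
rewrite [X in _ + X]mulrC -[X in _ + X]mulrA /homog_ham -/ham homog_B.
rewrite -/mom -[in RHS]m_dx.
by move: (homog _ _ _ dB) (homog _ _ _ F) (m a) => u v w; ring.
Qed.

Lemma flow_Py_homog_C : flow (fun a y pa py => py * homog_ham C a y pa py)
  (2 * a * py * (momentum a y pa py * homog_ham B a y pa py)).
Proof.
apply: is_lie_derive_eq (is_lie_deriveM flow_Py (flow_homog_ham C_ode)) _.
rewrite homogZ /homog_ham -/ham -/mom /Py; move: (homog _ _ _ _) => u.
by rewrite -[in RHS]m_dx; move: (m a) => v; ring.
Qed.

Lemma flow_linear_integral : flow linear_integral 0.
Proof.
apply: is_lie_derive_eq (is_lie_deriveD flow_momentum_homog_B
  (is_lie_deriveM flow_y flow_Py_homog_F)) _.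
by move: (homog_ham _ _ _ _ _) => u; ring.
Qed.

Lemma flow_quadratic_integral : flow quadratic_integral 0.
Proof.
have flow_y2 := is_lie_deriveM (is_lie_deriveM flow_y flow_y)
  (is_lie_derive_cst a y pa py (- (2 * mom * m a)) (- (2 * a * py))
    (2 * mom * dm * pa + py ^+ 2) 0 2^-1).
apply: is_lie_derive_eq (is_lie_deriveD
  (is_lie_deriveD flow_Py_homog_C (is_lie_deriveM flow_y flow_momentum_homog_B))
  (is_lie_deriveM flow_y2 flow_Py_homog_F)) _.
move: (homog_ham (fun=> F) _ _ _ _) (homog_ham B _ _ _ _) (momentum _ _ _ _).
by move=> u v w; field.
Qed.

Lemma pbracket_linear_integral :
  pbracket geodesic_ham linear_integral a y pa py = 0.
Proof. exact: flow_pbracket flow_linear_integral. Qed.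

Lemma pbracket_quadratic_integral :
  pbracket geodesic_ham quadratic_integral a y pa py = 0.
Proof. exact: flow_pbracket flow_quadratic_integral. Qed.

End Integrals.

Lemma pbracket_geodesic_Py : pbracket geodesic_ham (@Py R) a y pa py = 0.
Proof. exact: flow_pbracket flow_Py. Qed.

End GeodesicFlow.

Lemma nonroot_near {K : numFieldType} (p : {poly K}) (x e : K) :
  p != 0 -> 0 < e ->
  exists2 x', `|x' - x| < e & p.[x'] != 0.
Proof.
move=> p_neq0 e_gt0; pose g k : K := x + e / k.+2%:R.
have g_near k : `|g k - x| < e.
  rewrite /g addrC addKr gtr0_norm ?divr_gt0 ?ltr0n //.
  by rewrite ltr_pdivrMr ?ltr0n // ltr_pMr // ltr1n.
have g_inj : injective g.
  move=> j k /addrI/(mulfI (lt0r_neq0 e_gt0))/invr_inj/eqP.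
  by rewrite eqr_nat => /eqP[].
have [all_root|/allPn[_ /mapP[k _ ->]]] :=
    boolP (all (root p) [seq g k | k <- iota 0 (size p)]); last by exists (g k).
have := max_poly_roots p_neq0 all_root.
by rewrite size_map size_iota ltnn map_inj_uniq ?iota_uniq // => /(_ isT).
Qed.

(* Columns 1, 2, 3 are triangular once the rows are taken in the order 2, 0, 1. *)
Lemma mxrank_triangular34 {K : fieldType} (A : 'M[K]_(3, 4)) :
  A 0 1 = 0 -> A 1 1 = 0 -> A 1 2 = 0 ->
  A 0 2 != 0 -> A 1 3 != 0 -> A 2 1 != 0 ->
  \rank A = 3%N.
Proof.
move=> A01 A11 A12 A02 A13 A21; apply/eqP; rewrite -/(row_free A) -kermx_eq0.
apply/rowV0P => v /sub_kermxP/matrixP vA.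
have sum3 (h : 'I_3 -> K) : \sum_i h i = h 0 + h 1 + h 2.
  rewrite !big_ord_recr big_ord0 /= add0r.
  by congr (h _ + h _ + h _); exact: val_inj.
have col j : v 0 0 * A 0 j + v 0 1 * A 1 j + v 0 2 * A 2 j = 0.
  by have := vA 0 j; rewrite !mxE sum3.
have v2 : v 0 2 = 0.
  have /eqP := col 1.
  by rewrite A01 A11 !mulr0 !add0r mulf_eq0 (negPf A21) orbF => /eqP.
have v0 : v 0 0 = 0.
  have /eqP := col 2.
  by rewrite A12 v2 mulr0 mul0r !addr0 mulf_eq0 (negPf A02) orbF => /eqP.
have v1 : v 0 1 = 0.
  have /eqP := col 3.
  by rewrite v0 v2 !mul0r add0r addr0 mulf_eq0 (negPf A13) orbF => /eqP.
apply/rowP => i; rewrite mxE; case: i => [[|[|[|//]]]] lti.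
- by rewrite -v0; congr (v _ _); apply: val_inj.
- by rewrite -v1; congr (v _ _); apply: val_inj.
- by rewrite -v2; congr (v _ _); apply: val_inj.
Qed.

Section FunctionalIndependence.
Context {R : realType}.
Implicit Types f g : pfun R.

Lemma rank_jac3_Py f g a y pa py :
  d_y f a y pa py = 0 -> d_Pa f a y pa py != 0 -> d_y g a y pa py != 0 ->
  \rank (jac3 f (@Py R) g a y pa py) = 3%N.
Proof.
move=> fy fpa gy.
have [_ Pyy Pypa Pypy] := gradientE (is_gradient_Py a y pa py).
apply: mxrank_triangular34; rewrite mxE //= ?fy //.
by rewrite Pypy oner_neq0.
Qed.

Lemma homog_ham_neq0_near n (F : {poly R}) (m : R -> R) (a pa py e : R) :
  F != 0 -> (size F <= n.+1)%N -> m a != 0 -> 0 < e ->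
  exists pa' py', [/\ `|pa' - pa| < e, `|py' - py| < e, pa' != 0 &
    forall y, py' * homog_ham m n (fun=> F) a y pa' py' != 0].
Proof.
move=> F_neq0 size_F m_neq0 e_gt0.
have X_neq0 : 'X != 0 :> {poly R} by rewrite polyX_eq0.
have [q qe] := nonroot_near py X_neq0 e_gt0; rewrite hornerX => q_neq0.
pose r := (m a / q) ^+ 2 *: 'X^2 + a%:P.
have lead_neq0 : (m a / q) ^+ 2 != 0.
  by rewrite expf_neq0 // mulf_neq0 ?invr_eq0.
have r_nonconst : (1 < size r)%N.
  rewrite size_polyDl size_scale // size_polyXn //.
  by rewrite (leq_ltn_trans (size_polyC_leq1 _)).
have Fr_neq0 : 'X * (F \Po r) != 0 by rewrite mulf_neq0 // comp_poly_eq0.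
have [p pe] := nonroot_near pa Fr_neq0 e_gt0.
rewrite hornerM hornerX horner_comp mulf_eq0 negb_or => /andP[p_neq0 Fp_neq0].
exists p, q; split => // y; rewrite /homog_ham homogE ?expf_neq0 //.
rewrite !mulf_neq0 ?expf_neq0 //.
suff -> : geodesic_ham m a y p q / q ^+ 2 = r.[p] by [].
rewrite /r hornerD hornerZ hornerXn hornerC /geodesic_ham /momentum.
by move: (m a) => u; field.
Qed.

Section GeodesicIndependence.
Variables (n : nat) (F : {poly R}) (m : R -> R) (I : set R).
Hypothesis F_neq0 : F != 0.
Hypothesis size_F : (size F <= n.+1)%N.
Hypothesis m_regular : forall a, I a -> derivable m a 1 /\ m a != 0.

Let G a pa py := py * homog_ham m n (fun=> F) a 0 pa py.

Lemma funct_indep_geodesic (S : pfun R) (P : R -> R -> R -> {poly R}) :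
  (forall a y pa py, I a -> S a y pa py = (P a pa py).[y]) ->
  (forall a pa py, G a pa py != 0 -> (P a pa py)^`() != 0) ->
  funct_indep I (geodesic_ham m) (@Py R) S.
Proof.
move=> SP dP_neq0 a y pa py Ia e e_gt0; have [dm m_neq0] := m_regular Ia.
have [pa' [py' [pae pye pa_neq0 /(_ 0)/dP_neq0 dPy_neq0]]] :=
  homog_ham_neq0_near pa py F_neq0 size_F m_neq0 e_gt0.
have [y' ye dSy] := nonroot_near y dPy_neq0 e_gt0.
exists a, y', pa', py'; split; first by split; rewrite ?subrr ?normr0.
have [_ Hy Hpa _] :=
  gradientE (geodesic_ham_gradient y' pa' py' (derivableP dm)).
apply: rank_jac3_Py => //.
  have two_neq0 : 2 != 0 :> R by rewrite pnatr_eq0.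
  have mom_neq0 := mulf_neq0 m_neq0 pa_neq0.
  rewrite Hpa; exact: mulf_neq0 (mulf_neq0 two_neq0 mom_neq0) m_neq0.
rewrite /d_y (_ : (fun t => S a t pa' py') = horner (P a pa' py')).
  by rewrite derive1E derive_val.
by apply: funext => t; exact: SP.
Qed.

Variables B C : R -> {poly R}.

Let L a pa py := momentum m a 0 pa py * homog_ham m n B a 0 pa py.
Let K a pa py := py * homog_ham m n C a 0 pa py.

Lemma funct_indep_linear_integral (S : pfun R) :
  (forall a y pa py, I a ->
     S a y pa py = linear_integral m n F B a y pa py) ->
  funct_indep I (geodesic_ham m) (@Py R) S.
Proof.
move=> SE; apply: (funct_indep_geodesic
  (P := fun a pa py => (L a pa py)%:P + G a pa py *: 'X)).
  by move=> a y pa py Ia; rewrite SE // hornerD hornerC hornerZ hornerX mulrC.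
move=> a pa py G0.
by rewrite derivD derivC derivZ derivX add0r scaler_eq0 (negPf G0) oner_eq0.
Qed.

Lemma funct_indep_quadratic_integral (S : pfun R) :
  (forall a y pa py, I a ->
     S a y pa py = quadratic_integral m n F B C a y pa py) ->
  funct_indep I (geodesic_ham m) (@Py R) S.
Proof.
move=> SE; apply: (funct_indep_geodesic (P := fun a pa py =>
  (K a pa py)%:P + L a pa py *: 'X + (G a pa py / 2) *: 'X^2)).
  move=> a y pa py Ia; rewrite SE // !hornerD hornerC !hornerZ hornerX hornerXn.
  rewrite -[LHS]/(K a pa py + y * L a pa py + y ^+ 2 / 2 * G a pa py).
  by move: (G _ _ _) (L _ _ _) (K _ _ _) => g l k; field.
move=> a pa py G0; rewrite !derivD derivC !derivZ derivX derivXn add0r.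
apply/eqP => /(congr1 (fun p : {poly R} => p`_1)).
rewrite /= coefD !coefZ coefMn coef1 coefX coef0 mulr0 add0r.
by rewrite eqxx mulr1n divfK ?pnatr_eq0 //; exact/eqP.
Qed.

End GeodesicIndependence.
End FunctionalIndependence.

Lemma size_XsubCM {R : nzRingType} (p : {poly R}) (b : R) :
  p \is monic -> size (('X - b%:P) * p) = (size p).+1.
Proof.
by move=> p1; rewrite size_monicM ?monicXsubC ?monic_neq0 // size_XsubC.
Qed.

Section SignedCoefficients.
Context {R : nzRingType}.
Implicit Types p : {poly R}.

(* [sigma_i ai i] and [sigma_ij ai i j] are, by conversion, instances of this for
the polynomials [Fpoly_i ai i] and [Fpoly_ij ai i j]. *)
Definition signed_coef (d : nat) p (j : int) : R :=
  match j with
  | Posz k => if (k <= d)%N then (-1) ^+ k * p`_(d - k) else 0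
  | Negz _ => 0
  end.

Lemma coef_signed_coef p (n d j e k : nat) :
  (size p <= d.+1)%N -> n = (d + j + e)%N -> (k <= n)%N ->
  ('X^e * p)`_(n - k) = (-1) ^+ (k + j) * signed_coef d p (k%:Z - j%:Z).
Proof.
move=> sp -> kd; rewrite coefXnM; case: (ltnP k j) => [kj|jk].
  have -> : k%:Z - j%:Z = Negz (j - k).-1 by lia.
  by rewrite mulr0 nth_default ?if_same //; apply: leq_trans sp _; lia.
have -> : k%:Z - j%:Z = Posz (k - j) by lia.
rewrite /=; case: (leqP (k - j) d) => kjd; last first.
  by rewrite mulr0 ifT //; lia.
rewrite ifF; last lia.
rewrite mulrA -exprD (_ : (k + j + (k - j))%N = (2 * k)%N); last lia.
rewrite exprM sqrrN expr1n expr1n mul1r; congr (_`_ _); lia.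
Qed.

End SignedCoefficients.

Section RootPolynomials.
Context {R : realType} {n : nat}.
Variable ai : 'I_n -> R.
Local Notation F := (Fpoly ai).
Local Notation Fi := (Fpoly_i ai).
Local Notation Fij := (Fpoly_ij ai).

Lemma Fpoly_factor i : F = ('X - (ai i)%:P) * Fi i.
Proof. by rewrite /Fpoly (bigD1 i). Qed.

Lemma Fpoly_i_factor i j : j != i -> Fi i = ('X - (ai j)%:P) * Fij i j.
Proof. by move=> ji; rewrite /Fpoly_i (bigD1 j). Qed.

Lemma Fpoly_i_mul i j : j != i -> Fi i * Fi j = F * Fij i j.
Proof. by move=> ji; rewrite (Fpoly_factor j) (Fpoly_i_factor ji) mulrAC. Qed.

Lemma Fpoly_neq0 : F != 0.
Proof. by rewrite monic_neq0 // monic_prod_XsubC. Qed.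

Lemma size_Fpoly : size F = n.+1.
Proof. by rewrite size_prod_XsubC /index_enum -enumT size_enum_ord. Qed.

Lemma size_Fpoly_i i : size (Fi i) = n.
Proof.
apply/eqP; rewrite -eqSS -size_Fpoly (Fpoly_factor i).
by rewrite size_XsubCM ?monic_prod_XsubC.
Qed.

Lemma size_Fpoly_ij i j : j != i -> size (Fij i j) = n.-1.
Proof.
move=> ji; rewrite -[in RHS](size_Fpoly_i i) (Fpoly_i_factor ji).
by rewrite size_XsubCM ?monic_prod_XsubC.
Qed.

Lemma coef_Fpoly k : (k <= n)%N -> F`_(n - k) = (-1) ^+ k * sigma ai k.
Proof. by move=> kn; rewrite /sigma kn mulrA -expr2 sqrr_sign mul1r. Qed.

Lemma coef_Fpoly_i i k : (k <= n)%N ->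
  (Fi i)`_(n - k) = - ((-1) ^+ k * sigma_i ai i (k%:Z - 1)).
Proof.
move=> kn; have i_lt_n := ltn_ord i.
rewrite -[Fi i]mul1r (@coef_signed_coef _ _ n n.-1 1 0); last 3 first.
- by rewrite size_Fpoly_i leqSpred.
- lia.
- by [].
by rewrite exprD mulrN1 mulNr.
Qed.

Lemma coef_XFpoly_i i k : (k <= n)%N ->
  ('X * Fi i)`_(n - k) = (-1) ^+ k * sigma_i ai i k%:Z.
Proof.
move=> kn; have i_lt_n := ltn_ord i.
rewrite (@coef_signed_coef _ _ n n.-1 0 1); last 3 first.
- by rewrite size_Fpoly_i leqSpred.
- lia.
- by [].
by rewrite addn0 subr0.
Qed.

Lemma ord_neq_gt1 (i j : 'I_n) : j != i -> (1 < n)%N.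
Proof. by rewrite -val_eqE /=; have := ltn_ord i; have := ltn_ord j; lia. Qed.

Lemma coef_Fpoly_ij i j k : j != i -> (k <= n)%N ->
  (Fij i j)`_(n - k) = (-1) ^+ k * sigma_ij ai i j (k%:Z - 2).
Proof.
move=> ji kn; have n1 := ord_neq_gt1 ji.
rewrite -[Fij i j]mul1r (@coef_signed_coef _ _ n n.-2 2 0); last 3 first.
- by rewrite size_Fpoly_ij // leqSpred.
- lia.
- by [].
by rewrite exprD sqrrN expr1n mulr1.
Qed.

Lemma coef_XFpoly_ij i j k : j != i -> (k <= n)%N ->
  ('X * Fij i j)`_(n - k) = - ((-1) ^+ k * sigma_ij ai i j (k%:Z - 1)).
Proof.
move=> ji kn; have n1 := ord_neq_gt1 ji.
rewrite (@coef_signed_coef _ _ n n.-2 1 1); last 3 first.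
- by rewrite size_Fpoly_ij // leqSpred.
- lia.
- by [].
by rewrite exprD mulrN1 mulNr.
Qed.

Lemma coef_XsubC_Fpoly_i i (a : R) k : (k <= n)%N ->
  (('X - a%:P) * Fi i)`_(n - k) =
  (-1) ^+ k * (sigma_i ai i k%:Z + a * sigma_i ai i (k%:Z - 1)).
Proof.
move=> kn; rewrite mulrBl coefB coefCM coef_XFpoly_i // coef_Fpoly_i //; ring.
Qed.

Lemma coef_XsubC_Fpoly_ij i j (a : R) k : j != i -> (k <= n)%N ->
  (('X - a%:P) * Fij i j)`_(n - k) =
  - ((-1) ^+ k * (sigma_ij ai i j (k%:Z - 1) + a * sigma_ij ai i j (k%:Z - 2))).
Proof.
move=> ji kn; rewrite mulrBl coefB coefCM coef_XFpoly_ij // coef_Fpoly_ij //.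
ring.
Qed.

End RootPolynomials.

Section CoefficientPolynomials.
Context {R : realType} {n : nat}.
Variables (ai eps xi : 'I_n -> R) (nu : R).
Implicit Types (u : 'I_n -> R) (a : R).
Local Notation F := (Fpoly ai).
Local Notation Fi := (Fpoly_i ai).
Local Notation Fij := (Fpoly_ij ai).

Definition xterm (i : 'I_n) (a : R) : R := xi i / Num.sqrt (Delta ai eps i a).

Definition btil_poly u : {poly R} := nu *: F - \sum_i u i *: Fi i.

Definition ctil_poly u a : {poly R} := - 2^-1 *:
  ((nu ^+ 2 * a) *: F + (2 * nu) *: (('X - a%:P) * \sum_i u i *: Fi i)
   - \sum_i u i ^+ 2 *: Fi i
   - ('X - a%:P) * \sum_i \sum_(j | j != i) (u i * u j) *: Fij i j).

Lemma sqr_sum_Fpoly_i u : (\sum_i u i *: Fi i) ^+ 2 =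
  \sum_i u i ^+ 2 *: Fi i ^+ 2 +
  F * \sum_i \sum_(j | j != i) (u i * u j) *: Fij i j.
Proof.
rewrite expr2 big_distrlr mulr_sumr -big_split; apply: eq_bigr => i _ /=.
rewrite (bigD1 i) //= mulr_sumr -scalerAl -scalerAr scalerA -!expr2.
congr (_ + _); apply: eq_bigr => j ji.
by rewrite -scalerAl -scalerAr scalerA Fpoly_i_mul // scalerAr.
Qed.

Lemma Fpoly_mul_sum_Fpoly_i u a : F * \sum_i u i ^+ 2 *: Fi i =
  ('X - a%:P) * (\sum_i u i ^+ 2 *: Fi i ^+ 2) +
  \sum_i (u i ^+ 2 * (a - ai i)) *: Fi i ^+ 2.
Proof.
rewrite !mulr_sumr -big_split; apply: eq_bigr => i _ /=.
by rewrite (Fpoly_factor ai i) -!mul_polyC !polyCM polyCB; ring.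
Qed.

(* Homogenized, this reads [2 G Q2 = Q1^2 + c(H, P_y)], with [c] depending on the
conserved quantities [H] and [P_y] alone. *)
Lemma Fpoly_mul_ctil_poly u a : F * (2 *: ctil_poly u a) =
  ('X - a%:P) * btil_poly u ^+ 2 - nu ^+ 2 *: ('X * F ^+ 2)
  + \sum_i (u i ^+ 2 * (a - ai i)) *: Fi i ^+ 2.
Proof.
have := Fpoly_mul_sum_Fpoly_i u a; have := sqr_sum_Fpoly_i u.
rewrite /ctil_poly /btil_poly scalerA mulrN mulfV ?pnatr_eq0 // scaleN1r.
set s := \sum_i u i *: _; set D := \sum_i \sum_(j | _) _.
set M := \sum_i u i ^+ 2 *: Fi i; set N := \sum_i u i ^+ 2 *: _.
move=> sE; have -> : N = s ^+ 2 - F * D by rewrite sE addrK.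
move=> /(canLR (addKr _)) <-.
rewrite -!mul_polyC !polyCM (_ : 2%:P = 2) ?polyC_natr //; ring.
Qed.

Lemma coef_btil_poly a k : (k <= n)%N ->
  (btil_poly (xterm ^~ a))`_(n - k) = btil ai eps xi nu k a.
Proof.
move=> kn; rewrite /btil_poly coefB coefZ coef_Fpoly // coef_sum /btil mulrDr.
congr (_ + _); first exact: mulrCA.
rewrite mulr_sumr -sumrN; apply: eq_bigr => i _.
by rewrite coefZ coef_Fpoly_i // mulrN opprK mulrCA.
Qed.

Lemma coef_ctil_poly a k :
  (forall i, 0 < Delta ai eps i a) -> (k <= n)%N ->
  (ctil_poly (xterm ^~ a) a)`_(n - k) = ctil ai eps xi nu k a.
Proof.
move=> Delta_gt0 kn.
rewrite /ctil_poly coefZ 2!coefB coefD !mulr_sumr !coef_sum /ctil.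
have -> : (-1) ^+ k.+1 / 2 = - 2^-1 * (-1) ^+ k :> R by rewrite exprS; ring.
rewrite -[RHS]mulrA; congr (_ * _); rewrite !mulrDr.
congr (_ + _ + _ + _).
- by rewrite coefZ coef_Fpoly // mulrCA.
- rewrite coefZ coef_sum mulrCA; congr (_ * _).
  rewrite mulr_sumr; apply: eq_bigr => i _.
  by rewrite -scalerAr coefZ coef_XsubC_Fpoly_i // mulrCA.
- rewrite mulr_sumr -sumrN; apply: eq_bigr => i _.
  rewrite coefZ coef_Fpoly_i // mulrN opprK mulrCA.
  by rewrite /xterm expr_div_n sqr_sqrtr // ltW.
rewrite mulr_sumr -sumrN; apply: eq_bigr => i _.
rewrite !mulr_sumr coef_sum -sumrN; apply: eq_bigr => j ji.
rewrite -scalerAr coefZ coef_XsubC_Fpoly_ij // mulrN opprK mulrCA.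
by rewrite /xterm mulf_div -sqrtrM // ltW.
Qed.

End CoefficientPolynomials.

Section CoefficientPolynomialDerivatives.
Context {R : realType} {n : nat}.
Variables (ai : 'I_n -> R) (nu a : R) (u : 'I_n -> R -> R) (du : 'I_n -> R).
Hypothesis u_du : forall i, is_derive a 1 (u i) (du i).
Hypothesis du_ode : forall i, 2 * (a - ai i) * du i = - u i a.
Local Notation F := (Fpoly ai).
Local Notation Fi := (Fpoly_i ai).
Local Notation Fij := (Fpoly_ij ai).
Local Notation B := (fun t : R => btil_poly ai nu (u ^~ t)).
Local Notation C := (fun t : R => ctil_poly ai nu (u ^~ t) t).
Local Notation dB := (- \sum_i du i *: Fi i).
Local Notation dx := (nu / 2 + \sum_i du i).

Lemma size_dbtil_poly : (size dB <= n)%N.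
Proof.
rewrite size_polyN; apply: leq_trans (size_sum _ _ _) _.
apply/bigmax_leqP => i _.
by rewrite (leq_trans (size_scale_leq _ _)) // size_Fpoly_i.
Qed.

Lemma is_derive_XsubC : is_derive_coef a (fun t => 'X - t%:P) (- 1).
Proof.
rewrite (_ : (fun t => _) = fun t => 'X + (- t) *: 1); last first.
  by apply: funext => t; rewrite -mul_polyC mulr1 polyCN.
apply: is_derive_coef_eq (is_derive_coefD (is_derive_coef_cst a 'X)
  (is_derive_coefZl 1 (is_deriveN (is_derive_id a (1 : R))))) _.
by rewrite add0r scaleN1r.
Qed.

Lemma is_derive_sum_Fpoly_i :
  is_derive_coef a (fun t => \sum_i u i t *: Fi i) (\sum_i du i *: Fi i).
Proof. by apply: is_derive_coef_sum => i; exact: is_derive_coefZl. Qed.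

Lemma is_derive_btil_poly : is_derive_coef a B dB.
Proof.
apply: is_derive_coef_eq
  (is_derive_coefB (is_derive_coef_cst a (nu *: F)) is_derive_sum_Fpoly_i) _.
exact: sub0r.
Qed.

Lemma btil_poly_ode : B a = 2 *: (('X - a%:P) * dB) + (2 * dx) *: F.
Proof.
rewrite /btil_poly mulrN scalerN mulr_sumr scaler_sumr.
rewrite mulrDr mulrCA divff ?pnatr_eq0 // mulr1 mulr_sumr.
rewrite scalerDl scaler_suml addrCA -!sumrN -big_split.
congr (_ + _); apply: eq_bigr => i _ /=.
rewrite (Fpoly_factor ai i) -scaleNr -du_ode -!mul_polyC !polyCM polyCB.
ring.
Qed.

Lemma is_derive_sqr_mul_subr i :
  is_derive a 1 (fun t => u i t ^+ 2 * (t - ai i)) 0.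
Proof.
have dt := is_deriveB (is_derive_id a (1 : R)) (is_derive_cst (ai i) a (1 : R)).
apply: is_derive_eq (is_deriveM (is_deriveM (u_du i) (u_du i)) dt) _.
rewrite -[LHS]/(u i a * u i a * (1 - 0) +
               (a - ai i) * (u i a * du i + u i a * du i)).
transitivity (u i a * (u i a + 2 * (a - ai i) * du i)); first ring.
by rewrite du_ode subrr mulr0.
Qed.

Lemma derivable_ctil_poly : exists dC, is_derive_coef a C dC.
Proof.
have ddiag : is_derive_coef a (fun t => \sum_i u i t ^+ 2 *: Fi i)
    (\sum_i (u i a * du i + u i a * du i) *: Fi i).
  by apply: is_derive_coef_sum => i; apply: is_derive_coefZl; exact: is_deriveM.
have doff : is_derive_coef a
    (fun t => \sum_i \sum_(j | j != i) (u i t * u j t) *: Fij i j)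
    (\sum_i \sum_(j | j != i) (u i a * du j + u j a * du i) *: Fij i j).
  apply: is_derive_coef_sum => i; apply: is_derive_coef_sum => j.
  by apply: is_derive_coefZl; exact: is_deriveM.
have dF := is_derive_coefZl F (is_deriveZ (nu ^+ 2) (is_derive_id a (1 : R))).
have dcross := is_derive_coefM is_derive_XsubC is_derive_sum_Fpoly_i.
have dpairs := is_derive_coefM is_derive_XsubC doff.
exact: (ex_intro _ _ (is_derive_coefZr (- 2^-1) (is_derive_coefB
  (is_derive_coefB (is_derive_coefD dF (is_derive_coefZr (2 * nu) dcross)) ddiag)
  dpairs))).
Qed.

Lemma is_derive_Fpoly_mul_ctil_poly :
  is_derive_coef a (fun t => F * (2 *: C t)) (- (2 * dx) *: (F * B a)).
Proof.
have dB2 := is_derive_coefM is_derive_btil_poly is_derive_btil_poly.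
have dconst : is_derive_coef a
    (fun t => \sum_i (u i t ^+ 2 * (t - ai i)) *: Fi i ^+ 2)
    (\sum_i 0 *: Fi i ^+ 2).
  apply: is_derive_coef_sum => i.
  exact/is_derive_coefZl/is_derive_sqr_mul_subr.
rewrite (funext (fun t => Fpoly_mul_ctil_poly ai nu (u ^~ t) t)).
apply: is_derive_coef_eq (is_derive_coefD (is_derive_coefB
  (is_derive_coefM is_derive_XsubC dB2)
  (is_derive_coef_cst a (nu ^+ 2 *: ('X * F ^+ 2)))) dconst) _.
rewrite [\sum_i 0 *: _]big1 => [|i _]; last by rewrite scale0r.
have odeF : (2 * dx) *: F = B a - 2 *: (('X - a%:P) * dB).
  by rewrite btil_poly_ode addrAC subrr add0r.
rewrite scaleNr scalerAl odeF -mul_polyC (_ : 2%:P = 2) ?polyC_natr //.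
by move: (btil_poly _ _ _) (\sum_i _) => b d; ring.
Qed.

Lemma is_derive_ctil_poly : is_derive_coef a C (- dx *: B a).
Proof.
have [dC C_dC] := derivable_ctil_poly.
have F_dC := is_derive_coefM (is_derive_coef_cst a F) (is_derive_coefZr 2 C_dC).
apply: is_derive_coef_eq C_dC _.
have two_neq0 : 2 != 0 :> R by rewrite pnatr_eq0.
apply: (scalerI two_neq0); apply: (mulfI (Fpoly_neq0 ai)).
have := is_derive_coef_unique F_dC is_derive_Fpoly_mul_ctil_poly.
by rewrite mul0r addr0 => ->; rewrite scalerA mulrN scalerAr.
Qed.

End CoefficientPolynomialDerivatives.

Section Superintegrability.
Context {R : realType} {n : nat}.
Variables (ai eps xi : 'I_n -> R) (nu : R).
Hypothesis eps_neq0 : forall i, eps i != 0.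
Local Notation u := (xterm ai eps xi).
Local Notation m := (fun t : R => t / xdot ai eps xi nu t).
Local Notation B := (fun t : R => btil_poly ai nu (u ^~ t)).
Local Notation C := (fun t : R => ctil_poly ai nu (u ^~ t) t).
Local Notation xd := (xdot ai eps xi nu).

Definition dxterm (i : 'I_n) (t : R) : R := - u i t / (2 * (t - ai i)).

Lemma Delta_neq0 i t : 0 < Delta ai eps i t -> t - ai i != 0.
Proof. by move=> /lt0r_neq0; rewrite mulf_eq0 negb_or => /andP[]. Qed.

Lemma is_derive_xterm i t : 0 < Delta ai eps i t ->
  is_derive t 1 (u i) (dxterm i t).
Proof.
move=> Delta_gt0; have t_neq := Delta_neq0 Delta_gt0.
have sqrt0 : Num.sqrt (Delta ai eps i t) != 0 by rewrite gt_eqF ?sqrtr_gt0.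
have dD : is_derive t 1 (Delta ai eps i) (eps i *: 1).
  exact: is_deriveZ (is_derive_shift t 1 (- ai i)).
have dsqrt := is_derive1_comp (is_derive1_sqrt Delta_gt0) dD.
rewrite -[u i]/(xi i \*: (fun s => (Num.sqrt (Delta ai eps i s))^-1)).
have dinv := is_deriveZ (xi i)
  (is_deriveV (f := Num.sqrt \o Delta ai eps i) sqrt0 dsqrt).
apply: is_derive_eq dinv _.
have sqrtE : Num.sqrt (Delta ai eps i t) ^+ 2 = eps i * (t - ai i).
  by rewrite sqr_sqrtr ?ltW.
rewrite /dxterm /xterm /= sqrtE scaler1 /GRing.scale /=.
move: (Num.sqrt _) sqrt0 (t - ai i) t_neq => s s0 d d0.
by field; rewrite s0 d0 eps_neq0.
Qed.

Lemma is_derive_xfun t : (forall i, 0 < Delta ai eps i t) ->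
  is_derive t 1 (xfun ai eps xi nu) (nu / 2 + \sum_i dxterm i t).
Proof.
move=> Delta_gt0; have dlin := is_deriveZ (nu / 2) (is_derive_id t (1 : R)).
have dsum := is_derive_sum (fun i => is_derive_xterm (Delta_gt0 i)).
rewrite (_ : xfun _ _ _ _ = (nu / 2 \*: id) + \sum_i u i); last first.
  by apply: funext => s; rewrite /xfun !fctE fct_sumE.
by apply: is_derive_eq (is_deriveD dlin dsum) _; rewrite scaler1.
Qed.

Lemma xdotE t : (forall i, 0 < Delta ai eps i t) ->
  xd t = nu / 2 + \sum_i dxterm i t.
Proof.
move=> Delta_gt0; have dx := is_derive_xfun Delta_gt0.
by rewrite /xdot derive1E derive_val.
Qed.

Lemma derivable_dxterm i t : 0 < Delta ai eps i t -> derivable (dxterm i) t 1.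
Proof.
move=> Delta_gt0; have du := is_derive_xterm Delta_gt0.
have dlin : is_derive t 1 (fun s => 2 * (s - ai i)) (2 *: 1).
  exact: is_deriveZ (is_derive_shift t 1 (- ai i)).
have lin_neq0 : 2 * (t - ai i) != 0.
  by rewrite mulf_neq0 ?pnatr_eq0 ?(Delta_neq0 Delta_gt0).
by have [] := is_deriveM (is_deriveN du)
  (is_deriveV (f := fun s => 2 * (s - ai i)) lin_neq0 dlin).
Qed.

Lemma derivable_xdot a : (\forall t \near a, forall i, 0 < Delta ai eps i t) ->
  derivable xd a 1.
Proof.
move=> Delta_near; have Delta_gt0 := nbhs_singleton Delta_near.
apply: (@near_eq_derivable _ _ _ (cst (nu / 2) + \sum_i dxterm i)).
  by near=> t; rewrite xdotE ?fctE ?fct_sumE //; near: t.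
apply: derivableD; first exact: derivable_cst.
by apply: derivable_sum => i; exact: derivable_dxterm.
Unshelve. all: by end_near. Qed.

Lemma dxterm_ode i t : 0 < Delta ai eps i t ->
  2 * (t - ai i) * dxterm i t = - u i t.
Proof.
move=> /Delta_neq0 t_neq; rewrite mulrC divfK //.
by rewrite mulf_neq0 ?pnatr_eq0.
Qed.

Lemma GfunE a y pa py :
  Gfun ai eps xi nu a y pa py = py * homog_ham m n (fun=> Fpoly ai) a y pa py.
Proof.
by rewrite mulr_sumr; apply: eq_bigr => k _; rewrite exprS exprM mulrCA.
Qed.

Lemma Q1E a y pa py : Q1 ai eps xi nu a y pa py =
  momentum m a y pa py * homog_ham m n B a y pa py.
Proof.
rewrite mulr_sumr; apply: eq_bigr => k _.
have kn : (k <= n)%N by rewrite -ltnS.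
rewrite (coef_btil_poly ai eps xi nu a kn) exprM.
rewrite -[geodesic_ham _ _ _ _ _]/(Ham ai eps xi nu a y pa py).
rewrite -[momentum _ _ _ _ _]/(Pi ai eps xi nu a y pa py); ring.
Qed.

Lemma Q2E a y pa py : (forall i, 0 < Delta ai eps i a) ->
  Q2 ai eps xi nu a y pa py = py * homog_ham m n C a y pa py.
Proof.
move=> Delta_gt0; rewrite mulr_sumr; apply: eq_bigr => k _.
have kn : (k <= n)%N by rewrite -ltnS.
by rewrite (coef_ctil_poly xi nu Delta_gt0 kn) exprS exprM mulrCA.
Qed.

Lemma S1E a y pa py :
  S1 ai eps xi nu a y pa py = linear_integral m n (Fpoly ai) B a y pa py.
Proof. by rewrite /S1 Q1E GfunE. Qed.

Lemma S2E a y pa py : (forall i, 0 < Delta ai eps i a) ->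
  S2 ai eps xi nu a y pa py = quadratic_integral m n (Fpoly ai) B C a y pa py.
Proof. by move=> Delta_gt0; rewrite /S2 Q1E GfunE Q2E. Qed.

Definition regular_point (a : R) : Prop :=
  (\forall t \near a, forall i, 0 < Delta ai eps i t) /\ xd a != 0.

Section RegularPoint.
Variable a : R.
Hypothesis a_regular : regular_point a.

Let Delta_gt0 : forall i, 0 < Delta ai eps i a := nbhs_singleton a_regular.1.
Let du i := is_derive_xterm (Delta_gt0 i).
Let du_ode i := dxterm_ode (Delta_gt0 i).

Lemma derivable_momentum_factor : derivable m a 1.
Proof.
have [Delta_near xdot_neq0] := a_regular.
apply: derivableM; first exact: derivable_id.
by apply: derivableV => //; exact: derivable_xdot.
Qed.

Lemma momentum_factor_mul_dx : m a * (nu / 2 + \sum_i dxterm i a) = a.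
Proof. by rewrite -xdotE // divfK //; case: a_regular. Qed.

Lemma pbracket_Ham_Py y pa py :
  pbracket (Ham ai eps xi nu) (@Py R) a y pa py = 0.
Proof.
have dm := derivableP derivable_momentum_factor.
exact: pbracket_geodesic_Py dm.
Qed.

Lemma pbracket_Ham_S1 y pa py :
  pbracket (Ham ai eps xi nu) (S1 ai eps xi nu) a y pa py = 0.
Proof.
have -> : S1 ai eps xi nu = linear_integral m n (Fpoly ai) B.
  by do 4 apply: funext => ?; exact: S1E.
have dm := derivableP derivable_momentum_factor.
exact: (pbracket_linear_integral y pa py dm
  (size_dbtil_poly ai (dxterm ^~ a)) momentum_factor_mul_dx
  (is_derive_btil_poly ai nu du) (btil_poly_ode nu du_ode)).
Qed.

Lemma pbracket_Ham_S2 y pa py :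
  pbracket (Ham ai eps xi nu) (S2 ai eps xi nu) a y pa py = 0.
Proof.
have S2_near : \forall t \near a, forall y pa py, S2 ai eps xi nu t y pa py =
    quadratic_integral m n (Fpoly ai) B C t y pa py.
  by apply: filterS a_regular.1 => t Dt *; exact: S2E.
rewrite (pbracket_near_eq _ _ _ _ S2_near).
have dm := derivableP derivable_momentum_factor.
exact: (pbracket_quadratic_integral y pa py dm
  (size_dbtil_poly ai (dxterm ^~ a)) momentum_factor_mul_dx
  (is_derive_btil_poly ai nu du) (btil_poly_ode nu du_ode)
  (is_derive_ctil_poly nu du du_ode)).
Qed.

End RegularPoint.

Section Independence.
Variable I : set R.
Hypothesis I_regular : forall a, I a -> a != 0 /\ regular_point a.

Lemma momentum_factor_regular a : I a -> derivable m a 1 /\ m a != 0.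
Proof.
move=> /I_regular[a0 a_reg]; split; first exact: derivable_momentum_factor.
by have [_ xdot_neq0] := a_reg; rewrite mulf_neq0 ?invr_eq0.
Qed.

Let size_F : (size (Fpoly ai) <= n.+1)%N.
Proof. by rewrite size_Fpoly. Qed.

Lemma funct_indep_Ham_S1 :
  funct_indep I (Ham ai eps xi nu) (@Py R) (S1 ai eps xi nu).
Proof.
apply: (funct_indep_linear_integral (Fpoly_neq0 ai) size_F
  momentum_factor_regular).
by move=> a y pa py _; exact: S1E.
Qed.

Lemma funct_indep_Ham_S2 :
  funct_indep I (Ham ai eps xi nu) (@Py R) (S2 ai eps xi nu).
Proof.
apply: (funct_indep_quadratic_integral (Fpoly_neq0 ai) size_F
  momentum_factor_regular).
move=> a y pa py /I_regular[_ [Delta_near _]].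
by apply: S2E; exact: nbhs_singleton Delta_near.
Qed.

End Independence.
End Superintegrability.

Theorem theorem2 (R : realType) (n : nat) (ai : 'I_n -> R)
  (eps xi : 'I_n -> R) (nu : R) (l r : \bar R) :
  (0 < n)%N ->
  injective ai ->
  (forall i, eps i = 1 \/ eps i = -1) ->
  (0 <= l)%E -> (l < r)%E ->
  (forall a : R, (l < a%:E)%E -> (a%:E < r)%E ->
     (forall i, 0 < Delta ai eps i a) /\ xdot ai eps xi nu a != 0) ->
  let I : set R := fun a => (l < a%:E)%E /\ (a%:E < r)%E in
  let H := Ham ai eps xi nu in
  (forall a y pa py, I a ->
     [/\ pbracket H (@Py R) a y pa py = 0,
         pbracket H (S1 ai eps xi nu) a y pa py = 0 &
         pbracket H (S2 ai eps xi nu) a y pa py = 0]) /\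
  funct_indep I H (@Py R) (S1 ai eps xi nu) /\
  funct_indep I H (@Py R) (S2 ai eps xi nu).
Proof.
move=> _ _ eps_sign l_ge0 _ regular I H.
have eps_neq0 i : eps i != 0.
  by case: (eps_sign i) => ->; rewrite ?oppr_eq0 oner_eq0.
have I_neq0 a : I a -> a != 0.
  by move=> [la _]; rewrite gt_eqF // -lte_fin (le_lt_trans l_ge0).
have I_near a : I a -> \forall t \near a, I t.
  move=> [la ar]; apply: filterI; apply: open_nbhs_nbhs; split=> //.
  - exact: open_ereal_gt.
  - exact: open_ereal_lt.
have I_regular a : I a -> regular_point ai eps xi nu a.
  move=> Ia; split; last by case: Ia => la ar; case: (regular a la ar).
  by apply: filterS (I_near a Ia) => t [lt tr]; case: (regular t lt tr).
have I_domain a : I a -> a != 0 /\ regular_point ai eps xi nu a.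
  by move=> Ia; split; [exact: I_neq0|exact: I_regular].
split; last by split; [exact: funct_indep_Ham_S1|exact: funct_indep_Ham_S2].
move=> a y pa py /I_regular a_regular.
by split; [exact: pbracket_Ham_Py|exact: pbracket_Ham_S1|exact: pbracket_Ham_S2].
Qed.
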